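(* Suppose that the system $x_{t+1}=f(x_t,w_t)$, $y_t=h(x_t)+v_t$ is i-IOSS (with functions $\beta\in\mathcal{KL}$, $\alpha_1,\alpha_2\in\mathcal K$) and that the infimum of the MHE optimization is attainable (i.e. exists and is numerically obtainable). Suppose that for every $t\ge T+1$ the prior estimate satisfies $|x_{t-T}-\bar x_{t-T}|\le|x_{t-T}-\hat x^{\star}_{t-T}|$, and let $\eta\in(0,1)$ be arbitrary. Then the MHE is RGAS for all $T\ge T_{\eta,\bar s}$ if its associated FIE satisfies Assumptions A1 and A2 stated in the context and the involved $\mathcal K$ and $\mathcal{KL}$ functions satisfy $$\bar\beta_x(s,T_{\eta,\bar s})+\alpha_1\left(3\underline\gamma_w^{-1}\left(3\rho_x(s,T_{\eta,\bar s})\right)\right)+\alpha_2\left(3\underline\gamma_v^{-1}\left(3\rho_x(s,T_{\eta,\bar s})\right)\right)\le\eta s$$ for all $s\in[0,\bar s]$, where $\bar s$ is the constant defined in the context. Furthermore, if both the disturbance $w_t$ and the noise $v_t$ converge to zero as $t$ goes to infinity, then the MHE estimate $\hat x_t^{\star}$ converges to the true state $x_t$.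
   Context: Notation. $\mathbb I_{\ge0}$ is the set of nonnegative integers, $\mathbb I_{a:b}$ the integers from $a$ to $b$; for discrete times, $t\ge0$ and $t\in\mathbb I_{\ge0}$ are used interchangeably. $|\cdot|$ is the Euclidean norm. $\boldsymbol x_{a:b}$ denotes $\{x_a,\dots,x_b\}$, $h(\boldsymbol x_{a:b})=\{h(x_a),\dots,h(x_b)\}$, and $\|\boldsymbol x_{a:b}\|:=\max_{a\le i\le b}|x_i|$ if $a\le b$, $0$ if $a>b$. $\alpha:\mathbb R_{\ge0}\to\mathbb R_{\ge0}$ is a $\mathcal K$ function if continuous, zero at zero and strictly increasing, and $\mathcal K_\infty$ if moreover $\alpha(s)\to\infty$ as $s\to\infty$. $\varphi:\mathbb R_{\ge0}\to\mathbb R_{\ge0}$ is an $\mathcal L$ function if continuous, nonincreasing and $\varphi(t)\to0$ as $t\to\infty$. $\beta:\mathbb R_{\ge0}^2\to\mathbb R_{\ge0}$ is a $\mathcal{KL}$ function if $\beta(\cdot,t)\in\mathcal K$ for each $t\ge0$ and $\beta(s,\cdot)\in\mathcal L$ for each $s\ge0$. System. $x_{t+1}=f(x_t,w_t)$, $y_t=h(x_t)+v_t$, with $x_t\in\mathbb R^n$, $y_t,v_t\in\mathbb R^p$, $w_t\in\mathbb R^g$; $f,h$ continuous and known; $x_0,w_t,v_t$ unknown but bounded. It is i-IOSS (incrementally input/output-to-state stable) if there exist $\beta\in\mathcal{KL}$, $\alpha_1,\alpha_2\in\mathcal K$ such that for all initial states $x_0^{(1)},x_0^{(2)}$ and disturbance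 sequences $\boldsymbol w^{(1)}_{0:t-1},\boldsymbol w^{(2)}_{0:t-1}$, with corresponding states $x_t^{(i)}$ of $x_{t+1}=f(x_t,w_t)$, for all $t\in\mathbb I_{\ge0}$: $|x_t^{(1)}-x_t^{(2)}|\le\beta(|x_0^{(1)}-x_0^{(2)}|,t)+\alpha_1(\|\boldsymbol w^{(1)}_{0:t-1}-\boldsymbol w^{(2)}_{0:t-1}\|)+\alpha_2(\|h(\boldsymbol x^{(1)}_{0:t})-h(\boldsymbol x^{(2)}_{0:t})\|)$. FIE (full information estimation). Given cost functions $V_t$ and a prior estimate $\bar x_0$ of $x_0$, the FIE at time $t$ minimizes $V_t(\chi_0-\bar x_0,\boldsymbol\omega_{0:t-1},\boldsymbol\nu_{0:t})$ over $(\chi_0,\boldsymbol\omega_{0:t-1},\boldsymbol\nu_{0:t})$ subject to $\chi_{\tau+1}=f(\chi_\tau,\omega_\tau)$ ($\tau\in\mathbb I_{0:t-1}$), $y_\tau=h(\chi_\tau)+\nu_\tau$ ($\tau\in\mathbb I_{0:t}$), $\chi_0\in\mathbb B_x^0$, $\boldsymbol\omega_{0:t-1}\in\mathbb B_w^{0:t-1}$, $\boldsymbol\nu_{0:t}\in\mathbb B_v^{0:t}$, where the $\mathbb B$'s are given sets of bounded initial states and bounded disturbance sequences (containing the true ones). $\hat x_t^{*}$ is the value of $\chi_t$ in an optimal solution at time $t$. MHE (moving horizon estimation). Given $T\in\mathbb I_{\ge0}$, the associated MHE at time $t\ge T$ minimizes $V_T(\chi_{t-T}-\bar x_{t-T},\boldsymbol\omega_{t-T:t-1},\boldsymbol\nu_{t-T:t})$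 subject to $\chi_{\tau+1}=f(\chi_\tau,\omega_\tau)$ ($\tau\in\mathbb I_{t-T:t-1}$), $y_\tau=h(\chi_\tau)+\nu_\tau$ ($\tau\in\mathbb I_{t-T:t}$), $\chi_{t-T}\in\mathbb B_x^{t-T}$, $\boldsymbol\omega_{t-T:t-1}\in\mathbb B_w^{t-T:t-1}$, $\boldsymbol\nu_{t-T:t}\in\mathbb B_v^{t-T:t}$, where $\bar x_{t-T}$ is a prior estimate of $x_{t-T}$. $\hat x_t^{\star}$ is the value of $\chi_t$ in an optimal solution of the MHE at time $t$. For $t<T$ the MHE estimate coincides with the FIE estimate. An MHE instance is treated as an instance of the associated FIE confined to the window $[t-T,t]$ (initial time $t-T$, prior $\bar x_{t-T}$), and the assumptions on and properties of the associated FIE are understood to apply to such time-shifted instances. RGAS (robust global asymptotic stability). An estimate $\hat x_t$ is RGAS if there exist $\beta_x\in\mathcal{KL}$, $\alpha_w,\alpha_v\in\mathcal K$ such that $|x_t-\hat x_t|\le\beta_x(|x_0-\bar x_0|,t)+\alpha_w(\|\boldsymbol w_{0:t-1}\|)+\alpha_v(\|\boldsymbol v_{0:t}\|)$ for all $x_0,\bar x_0$, $\boldsymbol w_{0:t-1}\in\mathbb B_w^{0:t-1}$, $\boldsymbol v_{0:t}\in\mathbb B_v^{0:t}$, $t\in\mathbb I_{\ge0}$. The MHE is RGAS if $\hat x_t^{\star}$ is. Assumption A1. $V_t(\chi_0-\bar x_0,\boldsymbol\omega_{0:t-1},\boldsymbol\nu_{0:t})=V_{t,1}(\chi_0-\bar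 x_0)+V_{t,2}(\boldsymbol\omega_{0:t-1},\boldsymbol\nu_{0:t})$ with $V_{t,1},V_{t,2}$ continuous and, for all $\chi_0\in\mathbb B_x^0$, $\boldsymbol\omega_{0:t-1}\in\mathbb B_w^{0:t-1}$, $\boldsymbol\nu_{0:t}\in\mathbb B_v^{0:t}$, $t\in\mathbb I_{\ge0}$: $\underline\rho_x(|\chi_0-\bar x_0|,t)\le V_{t,1}(\chi_0-\bar x_0)\le\rho_x(|\chi_0-\bar x_0|,t)$ and $\underline\gamma_w(\|\boldsymbol\omega_{0:t-1}\|)+\underline\gamma_v(\|\boldsymbol\nu_{0:t}\|)\le V_{t,2}(\boldsymbol\omega_{0:t-1},\boldsymbol\nu_{0:t})\le\gamma_w(\|\boldsymbol\omega_{0:t-1}\|)+\gamma_v(\|\boldsymbol\nu_{0:t}\|)$, where $\underline\rho_x,\rho_x\in\mathcal{KL}$ and $\underline\gamma_w,\underline\gamma_v,\gamma_w,\gamma_v\in\mathcal K_\infty$. Assumption A2. There are functions $\bar\beta_x\in\mathcal{KL}$, $\bar\alpha_w,\bar\alpha_v\in\mathcal K$ such that for all $s_x,s_w,s_v,t\ge0$: $\beta\left(s_x+\underline\rho_x^{-1}\left(\rho_x(s_x,t)+\gamma_w(s_w)+\gamma_v(s_v),t\right),t\right)\le\bar\beta_x(s_x,t)+\bar\alpha_w(s_w)+\bar\alpha_v(s_v)$, where $\underline\rho_x^{-1}(\cdot,t)$ is the inverse of $\underline\rho_x(\cdot,t)$ in its first argument at time $t$. Constant $\bar s$. Let $|x_0-\bar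 x_0|\le M_0$, $|w_t|\le M_w$, $|v_t|\le M_v$ for all $t\in\mathbb I_{\ge0}$. Then $\bar s:=\beta_x(M_0,0)+\frac1{1-\eta}(\alpha_w(M_w)+\alpha_v(M_v))$, where $\beta_x,\alpha_w,\alpha_v$ are the functions (of the RGAS property of the associated FIE) $\beta_x(s,t)=\bar\beta_x(s,t)+\alpha_1(3\underline\gamma_w^{-1}(3\rho_x(s,t)))+\alpha_2(3\underline\gamma_v^{-1}(3\rho_x(s,t)))$, $\alpha_w(s)=\bar\alpha_w(s)+\alpha_1(3s+3\underline\gamma_w^{-1}(3\gamma_w(s)))+\alpha_2(3\underline\gamma_v^{-1}(3\gamma_w(s)))$, $\alpha_v(s)=\bar\alpha_v(s)+\alpha_1(3\underline\gamma_w^{-1}(3\gamma_v(s)))+\alpha_2(3s+3\underline\gamma_v^{-1}(3\gamma_v(s)))$.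
   Formalization: The horizon is assumed to satisfy T ≥ 1: for T = 0 the condition on the prior compares the prior and the estimate at the same time, and the RGAS claim then fails (e.g. f = 0, h = 0, s̄ = 0, with a nonzero constant prior). *)

(* Defs.v *)
From HB Require Import structures.
From mathcomp Require Import all_boot all_order all_algebra.
From mathcomp Require Import all_classical all_reals all_analysis.

Set Implicit Arguments.
Unset Strict Implicit.
Unset Printing Implicit Defensive.

Import Order.TTheory GRing.Theory Num.Theory.
Import numFieldNormedType.Exports.

Local Open Scope classical_set_scope.
Local Open Scope ring_scope.

(* Functions on [0, +oo[ are total functions R -> R constrained only on
   [0, +oo[; their values at negative arguments are irrelevant. *)
Section ComparisonFunctions.
Variable R : realType.

Definition class_K (a : R -> R) : Prop :=
  [/\ {within `[0, +oo[%classic, continuous a},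
      a 0 = 0,
      (forall s, 0 <= s -> 0 <= a s) &
      (forall r s, 0 <= r -> r < s -> a r < a s)].

Definition class_Kinf (a : R -> R) : Prop :=
  class_K a /\ a s @[s --> +oo] --> +oo.

Definition class_L (phi : R -> R) : Prop :=
  [/\ {within `[0, +oo[%classic, continuous phi},
      (forall t, 0 <= t -> 0 <= phi t),
      (forall t u, 0 <= t -> t <= u -> phi u <= phi t) &
      phi t @[t --> +oo] --> 0].

Definition class_KL (b : R -> R -> R) : Prop :=
  (forall t, 0 <= t -> class_K (b ^~ t)) /\
  (forall s, 0 <= s -> class_L (b s)).

(* The inverse of [a] on [0, +oo[: the r >= 0 with a r = s (junk value 0 when
   there is none; for a in class_Kinf and s >= 0 it exists and is unique). *)
Definition Kinv (a : R -> R) (s : R) : R :=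
  xget 0 [set r | 0 <= r /\ a r = s].

End ComparisonFunctions.

Section Sequences.
Variable R : realType.

(* The library norm on matrices is the sup norm, hence this definition. *)
Definition enorm (q : nat) (u : 'rV[R]_q) : R :=
  Num.sqrt (\sum_(i < q) u ord0 i ^+ 2).

(* A finite sequence of N vectors of R^q is an N x q matrix (one per row);
   [window a N u] is the sequence u_a, ..., u_(a+N-1). *)
Definition window (q a N : nat) (u : nat -> 'rV[R]_q) : 'M[R]_(N, q) :=
  \matrix_(i < N) u (a + i)%N.

Definition seqnorm (N q : nat) (A : 'M[R]_(N, q)) : R :=
  \big[Num.max/0]_(i < N) enorm (row i A).

End Sequences.

Section System.
Variables (R : realType) (n p g : nat).
Variables (f : 'rV[R]_n -> 'rV[R]_g -> 'rV[R]_n) (h : 'rV[R]_n -> 'rV[R]_p).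

Fixpoint traj (x0 : 'rV[R]_n) (w : nat -> 'rV[R]_g) (t : nat) : 'rV[R]_n :=
  if t is k.+1 then f (traj x0 w k) (w k) else x0.

Definition iIOSS (beta : R -> R -> R) (alpha1 alpha2 : R -> R) : Prop :=
  forall (x1 x2 : 'rV[R]_n) (w1 w2 : nat -> 'rV[R]_g) (t : nat),
    enorm (traj x1 w1 t - traj x2 w2 t) <=
      beta (enorm (x1 - x2)) t%:R
      + alpha1 (seqnorm (window 0 t w1 - window 0 t w2))
      + alpha2 (seqnorm (window 0 t.+1 (h \o traj x1 w1)
                         - window 0 t.+1 (h \o traj x2 w2))).

(* The unknown data of a run of the system: initial state, its prior estimate,
   disturbance and measurement noise. *)
Record scenario := Scenario {
  sc_x0 : 'rV[R]_n;
  sc_xbar0 : 'rV[R]_n;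
  sc_w : nat -> 'rV[R]_g;
  sc_v : nat -> 'rV[R]_p }.

Definition state (d : scenario) : nat -> 'rV[R]_n := traj (sc_x0 d) (sc_w d).

Definition output (d : scenario) (t : nat) : 'rV[R]_p :=
  h (state d t) + sc_v d t.

(* Bx a, Bw a N, Bv a N: the sets of states at time a, and of length-N
   disturbance and noise sequences starting at time a. *)
Variables (Bx : nat -> set 'rV[R]_n)
  (Bw : nat -> forall N, set 'M[R]_(N, g))
  (Bv : nat -> forall N, set 'M[R]_(N, p)).

(* The true states, disturbances and noises belong to the sets used as
   constraints, and respect the uniform bounds M0, Mw, Mv. *)
Definition admissible (M0 Mw Mv : R) (d : scenario) : Prop :=
  [/\ (forall a, Bx a (state d a)),
      (forall a N, Bw a (window a N (sc_w d))),
      (forall a N, Bv a (window a N (sc_v d))),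
      enorm (sc_x0 d - sc_xbar0 d) <= M0 &
      forall t, enorm (sc_w d t) <= Mw /\ enorm (sc_v d t) <= Mv].

(* V t is the cost over a window of t transitions and t+1 measurements. *)
Variable V : forall t : nat,
  'rV[R]_n -> 'M[R]_(t, g) -> 'M[R]_(t.+1, p) -> R.

Definition feasible (a N : nat) (y : nat -> 'rV[R]_p)
    (chi : nat -> 'rV[R]_n) (om : nat -> 'rV[R]_g) (nu : nat -> 'rV[R]_p) :
    Prop :=
  [/\ (forall tau, (a <= tau < a + N)%N -> chi tau.+1 = f (chi tau) (om tau)),
      (forall tau, (a <= tau <= a + N)%N -> y tau = h (chi tau) + nu tau),
      Bx a (chi a),
      Bw a (window a N om) &
      Bv a (window a N.+1 nu)].

Definition window_cost (a N : nat) (prior : 'rV[R]_n)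
    (chi : nat -> 'rV[R]_n) (om : nat -> 'rV[R]_g) (nu : nat -> 'rV[R]_p) : R :=
  V (chi a - prior) (window a N om) (window a N.+1 nu).

(* Optimal solutions of the estimation problem on the window [a, a + N]. *)
Definition window_optimal (a N : nat) (prior : 'rV[R]_n) (y : nat -> 'rV[R]_p)
    (chi : nat -> 'rV[R]_n) (om : nat -> 'rV[R]_g) (nu : nat -> 'rV[R]_p) :
    Prop :=
  feasible a N y chi om nu /\
  forall chi' om' nu', feasible a N y chi' om' nu' ->
    window_cost a N prior chi om nu <= window_cost a N prior chi' om' nu'.

Definition fie_optimal (d : scenario) (t : nat) :=
  window_optimal 0 t (sc_xbar0 d) (output d).

(* xbar d k is the prior estimate of the state at time k in scenario d. *)
Definition mhe_optimal (T : nat) (xbar : scenario -> nat -> 'rV[R]_n)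
    (d : scenario) (t : nat) :=
  if (t < T)%N then fie_optimal d t
  else window_optimal (t - T) T (xbar d (t - T)%N) (output d).

Definition mhe_attainable (T : nat) (xbar : scenario -> nat -> 'rV[R]_n)
    (d : scenario) (t : nat) : Prop :=
  exists chi om nu, mhe_optimal T xbar d t chi om nu.

Definition is_mhe_estimate (T : nat) (xbar : scenario -> nat -> 'rV[R]_n)
    (d : scenario) (t : nat) (z : 'rV[R]_n) : Prop :=
  exists chi om nu, mhe_optimal T xbar d t chi om nu /\ z = chi t.

Definition RGAS (adm : scenario -> Prop) (xhat : scenario -> nat -> 'rV[R]_n) :
    Prop :=
  exists (bx : R -> R -> R) (aw av : R -> R),
    [/\ class_KL bx, class_K aw, class_K av &
      forall d, adm d -> forall t,
        enorm (state d t - xhat d t) <=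
          bx (enorm (sc_x0 d - sc_xbar0 d)) t%:R
          + aw (seqnorm (window 0 t (sc_w d)))
          + av (seqnorm (window 0 t.+1 (sc_v d)))].

(* The bounds hold on every window [a, a + t], since moving-horizon problems
   are time-shifted instances of the full-information one. *)
Definition assumption_A1 (rho_lo rho : R -> R -> R)
    (gw_lo gv_lo gw gv : R -> R) : Prop :=
  [/\ class_KL rho_lo /\ class_KL rho,
      class_Kinf gw_lo /\ class_Kinf gv_lo,
      class_Kinf gw /\ class_Kinf gv &
      exists (V1 : nat -> 'rV[R]_n -> R)
             (V2 : forall t, 'M[R]_(t, g) -> 'M[R]_(t.+1, p) -> R),
      [/\ forall t e om nu, V (t := t) e om nu = V1 t e + V2 t om nu,
          forall t, continuous (V1 t),
          forall t, continuous
            (fun q : 'M[R]_(t, g) * 'M[R]_(t.+1, p) => V2 t q.1 q.2) &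
          forall (a t : nat) (chi xb : 'rV[R]_n)
            (om : 'M[R]_(t, g)) (nu : 'M[R]_(t.+1, p)),
          Bx a chi -> Bw a om -> Bv a nu ->
          rho_lo (enorm (chi - xb)) t%:R <= V1 t (chi - xb)
            <= rho (enorm (chi - xb)) t%:R
          /\ gw_lo (seqnorm om) + gv_lo (seqnorm nu) <= V2 t om nu
            <= gw (seqnorm om) + gv (seqnorm nu)]].

End System.

Section Gains.
Variable R : realType.
Variables (beta : R -> R -> R) (alpha1 alpha2 : R -> R).
Variables (rho_lo rho : R -> R -> R) (gw_lo gv_lo gw gv : R -> R).
Variables (bbx : R -> R -> R) (baw bav : R -> R).

(* The surjectivity clause says that the inverse of rho_lo(., t) is defined on
   [0, +oo[, which is the range of its argument since gw is in class_Kinf. *)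
Definition assumption_A2 : Prop :=
  [/\ class_KL bbx, class_K baw, class_K bav,
      (forall (t : nat) s, 0 <= s ->
         exists2 r, 0 <= r & rho_lo r t%:R = s) &
      forall (sx sw sv : R) (t : nat), 0 <= sx -> 0 <= sw -> 0 <= sv ->
        beta (sx + Kinv (rho_lo ^~ t%:R) (rho sx t%:R + gw sw + gv sv)) t%:R
        <= bbx sx t%:R + baw sw + bav sv].

Definition fie_bx (s t : R) : R :=
  bbx s t + alpha1 (3 * Kinv gw_lo (3 * rho s t))
          + alpha2 (3 * Kinv gv_lo (3 * rho s t)).

Definition fie_aw (s : R) : R :=
  baw s + alpha1 (3 * s + 3 * Kinv gw_lo (3 * gw s))
        + alpha2 (3 * Kinv gv_lo (3 * gw s)).

Definition fie_av (s : R) : R :=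
  bav s + alpha1 (3 * Kinv gw_lo (3 * gv s))
        + alpha2 (3 * s + 3 * Kinv gv_lo (3 * gv s)).

Definition sbar (eta M0 Mw Mv : R) : R :=
  fie_bx M0 0 + (1 - eta)^-1 * (fie_aw Mw + fie_av Mv).

End Gains.

(* Main.v *)
(* Comparing the optimal cost on a window with the cost of the true trajectory
   bounds the estimated initial state, disturbances and noises; i-IOSS and A2
   turn this into an error bound of the form
     e_(a+N) <= fie_bx(|x_a - prior|, N) + fie_aw(|w|) + fie_av(|v|),
   where the sums inside the gains are split by a(x+y+z) <= a(3x)+a(3y)+a(3z).
   As fie_bx(s, T) <= eta s on [0, sbar], the error satisfies
     e_t <= eta e_(t-T) + c_t   for t > T,
   where sbar is exactly large enough for the error never to leave [0, sbar].
   Iterating gives a bound that decays like eta^(t/T - 1), and e_t -> 0 as soon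
   as c_t, which depends only on the last T steps, tends to 0. *)

Require Import Defs.
From HB Require Import structures.
From mathcomp Require Import all_boot all_order all_algebra.
From mathcomp Require Import ring lra.
From mathcomp Require Import all_classical all_reals all_analysis.

Set Implicit Arguments.
Unset Strict Implicit.
Unset Printing Implicit Defensive.

Import Order.TTheory GRing.Theory Num.Theory.
Import numFieldNormedType.Exports.

Local Open Scope classical_set_scope.
Local Open Scope ring_scope.

(** * Cauchy-Schwarz and triangle inequalities for the Euclidean norm *)

Section EuclideanNorm.
Variables (R : realType) (q : nat).
Implicit Types u v : 'rV[R]_q.

Lemma enorm_ge0 u : 0 <= enorm u.
Proof. exact: sqrtr_ge0. Qed.

Lemma enorm_sqr u : enorm u ^+ 2 = \sum_i u ord0 i ^+ 2.
Proof. by rewrite sqr_sqrtr// sumr_ge0// => i _; exact: sqr_ge0. Qed.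

Lemma enormN u : enorm (- u) = enorm u.
Proof. by congr Num.sqrt; apply: eq_bigr => i _; rewrite mxE sqrrN. Qed.

Lemma dot_le_enorm u v : \sum_i u ord0 i * v ord0 i <= enorm u * enorm v.
Proof.
(* The inner product becomes an opaque [S], so that distributing factors over sums below leaves it
   intact. *)
have [S SE] : exists S, \sum_i u ord0 i * v ord0 i = S by eexists.
rewrite SE.
have [v0|v_neq0] := eqVneq (enorm v) 0.
  have vi0 i : v ord0 i = 0.
    have : \sum_i v ord0 i ^+ 2 = 0 by rewrite -enorm_sqr v0 expr0n.
    move/psumr_eq0P => /(_ (fun i _ => sqr_ge0 _)) /(_ i isT) /eqP.
    by rewrite sqrf_eq0 => /eqP.
  by rewrite v0 mulr0 -SE big1// => i _; rewrite vi0 mulr0.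
have v_gt0 : 0 < enorm v by rewrite lt_def v_neq0 enorm_ge0.
(* The squared norm of [|v|^2 u - <u,v> v] is [|v|^2 (|u|^2 |v|^2 - <u,v>^2)]. *)
have : 0 <= enorm v ^+ 2 * ((enorm u * enorm v) ^+ 2 - S ^+ 2).
  have -> : enorm v ^+ 2 * ((enorm u * enorm v) ^+ 2 - S ^+ 2) =
            \sum_i (enorm v ^+ 2 * u ord0 i - S * v ord0 i) ^+ 2.
    transitivity (enorm v ^+ 2 ^+ 2 * (\sum_i u ord0 i ^+ 2)
        - (2 * enorm v ^+ 2 * S) * S + S ^+ 2 * (\sum_i v ord0 i ^+ 2)).
      by rewrite -!enorm_sqr; ring.
    have -> : 2 * enorm v ^+ 2 * S * S =
        \sum_i 2 * enorm v ^+ 2 * S * (u ord0 i * v ord0 i).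
      by rewrite -mulr_sumr SE.
    rewrite !mulr_sumr -sumrN -!big_split/=.
    by apply: eq_bigr => i _; ring.
  by apply: sumr_ge0 => i _; exact: sqr_ge0.
rewrite pmulr_rge0 ?exprn_gt0// subr_ge0 => S2_le.
rewrite (le_trans (ler_norm S))// -(@ler_pXn2r _ 2)// ?nnegrE//.
  by rewrite real_normK// num_real.
by rewrite mulr_ge0 ?enorm_ge0.
Qed.

Lemma enormD u v : enorm (u + v) <= enorm u + enorm v.
Proof.
rewrite -(@ler_pXn2r _ 2)// ?nnegrE ?enorm_ge0 ?addr_ge0 ?enorm_ge0//.
rewrite sqrrD !enorm_sqr.
have -> : \sum_i (u + v) ord0 i ^+ 2 = \sum_i u ord0 i ^+ 2
    + (\sum_i u ord0 i * v ord0 i) *+ 2 + \sum_i v ord0 i ^+ 2.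
  by rewrite -sumrMnl -!big_split/=; apply: eq_bigr => i _; rewrite mxE sqrrD.
by rewrite lerD2r lerD2l lerMn2r dot_le_enorm.
Qed.

Lemma enormB u v : enorm (u - v) <= enorm u + enorm v.
Proof. by rewrite (le_trans (enormD _ _))// enormN. Qed.

End EuclideanNorm.

(** * Maximum norms of finite sequences and of windows *)

Section SequenceNorm.
Variables (R : realType) (q : nat).

Lemma seqnorm_ge0 N (A : 'M[R]_(N, q)) : 0 <= seqnorm A.
Proof. exact: bigmax_ge_id. Qed.

Lemma enorm_row_le N (A : 'M[R]_(N, q)) i : enorm (row i A) <= seqnorm A.
Proof. exact: (le_bigmax 0 (fun i => enorm (row i A))). Qed.

Lemma seqnormP N (A : 'M[R]_(N, q)) c : 0 <= c ->
  (forall i, enorm (row i A) <= c) -> seqnorm A <= c.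
Proof. by move=> c0 Ac; exact: bigmax_le. Qed.

Lemma seqnormB N (A B : 'M[R]_(N, q)) :
  seqnorm (A - B) <= seqnorm A + seqnorm B.
Proof.
apply: seqnormP => [|i]; first by rewrite addr_ge0 ?seqnorm_ge0.
by rewrite linearB/= (le_trans (enormB _ _))// lerD ?enorm_row_le.
Qed.

Lemma enorm_le_window (u : nat -> 'rV[R]_q) a N j : (a <= j < a + N)%N ->
  enorm (u j) <= seqnorm (window a N u).
Proof.
move=> /andP[aj jN]; have jaN : (j - a < N)%N by rewrite ltn_subLR.
have := enorm_row_le (window a N u) (Ordinal jaN).
by rewrite rowK/= subnKC.
Qed.

Lemma window_le (u : nat -> 'rV[R]_q) a N c : 0 <= c ->
  (forall j, (a <= j < a + N)%N -> enorm (u j) <= c) ->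
  seqnorm (window a N u) <= c.
Proof.
move=> c0 uc; apply: seqnormP => // i.
by rewrite rowK uc// leq_addr ltn_add2l ltn_ord.
Qed.

Lemma window_sub (u : nat -> 'rV[R]_q) a N b M :
  (b <= a)%N -> (a + N <= b + M)%N ->
  seqnorm (window a N u) <= seqnorm (window b M u).
Proof.
move=> ba aNbM; apply: window_le => [|j /andP[aj jN]]; first exact: seqnorm_ge0.
by apply: enorm_le_window; rewrite (leq_trans ba aj) (leq_trans jN).
Qed.

Lemma eq_window (u v : nat -> 'rV[R]_q) a b N :
  (forall j, (j < N)%N -> u (a + j)%N = v (b + j)%N) ->
  window a N u = window b N v.
Proof. by move=> uv; apply/row_matrixP => i; rewrite !rowK uv. Qed.

End SequenceNorm.

(** * Closure properties and inverses of class K functions *)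

Section ClassK.
Variable R : realType.
Implicit Types a b : R -> R.

(** Extending [a] by the constant [a 0] on the left trades continuity on the half-line for plain
    continuity, which composes directly. *)
Lemma within_ge0_continuousP a : {within `[0, +oo[%classic, continuous a} <->
  continuous (fun s : R => a (Num.max 0 s)).
Proof.
split=> [/subspace_continuousP ca x|ca].
- apply: (@cvg_comp _ _ _ (Num.max 0) a _
    (within `[0, +oo[%classic (nbhs (Num.max 0 x)))); last first.
    by apply: ca => /=; rewrite in_itv/= andbT le_max lexx.
  have cm : Num.max 0 y @[y --> x] --> Num.max 0 x.
    by apply: (@continuous_max _ _ (cst 0) id); [exact: cvg_cst|exact: cvg_id].
  move=> P; rewrite withinE => -[U nU UP].
  have : \forall y \near x, U (Num.max 0 y) by exact: cm.
  apply: filterS => y Uy.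
  have : (U `&` `[0, +oo[%classic) (Num.max 0 y).
    by split => //=; rewrite in_itv/= andbT le_max lexx.
  by rewrite -UP => -[].
- apply: (@subspace_eq_continuous _ _ _ (fun s : R => a (Num.max 0 s))).
    by move=> x; rewrite inE/= in_itv/= andbT => x0; rewrite /from_subspace max_r.
  exact: continuous_subspaceT.
Qed.

Lemma class_K_ge0 a s : class_K a -> 0 <= s -> 0 <= a s.
Proof. by case=> _ _ + _; exact. Qed.

Lemma class_K_le a r s : class_K a -> 0 <= r -> r <= s -> a r <= a s.
Proof.
case=> _ _ _ mono r0; rewrite le_eqVlt => /predU1P[->//|rs].
by rewrite ltW// mono.
Qed.

Lemma class_K_comp a b : class_K a -> class_K b -> class_K (fun s => a (b s)).
Proof.
move=> [+ a0 age0 amono] [/within_ge0_continuousP cb b0 bge0 bmono].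
move=> /within_ge0_continuousP ca.
split=> [||s s0|r s r0 rs]; last 3 first.
- by rewrite b0.
- by rewrite age0// bge0.
- by apply: amono; [exact: bge0|exact: bmono].
apply/within_ge0_continuousP => x.
(* The inner value is nonnegative, so a second [Num.max 0] can be inserted; the map is then a
   composition of the two extensions. *)
under eq_fun do rewrite -(max_r (bge0 _ _)) ?le_max ?lexx//.
apply: (@continuous_comp _ _ _ (fun s : R => b (Num.max 0 s))
  (fun s : R => a (Num.max 0 s))); [exact: cb|exact: ca].
Qed.

Lemma class_K_add a b : class_K a -> class_K b -> class_K (fun s => a s + b s).
Proof.
move=> [ca a0 age0 amono] [cb b0 bge0 bmono].
split=> [||s s0|r s r0 rs].
- exact: within_continuousD.
- by rewrite a0 b0 addr0.
- by rewrite addr_ge0 ?age0 ?bge0.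
- by rewrite ltrD ?amono ?bmono.
Qed.

Lemma class_K_id : class_K (@id R).
Proof. by split=> //; apply: continuous_subspaceT => x; exact: cvg_id. Qed.

Lemma class_K_scale a c : 0 < c -> class_K a -> class_K (fun s => c * a s).
Proof.
move=> c0 [ca a0 age0 amono].
split=> [||s s0|r s r0 rs].
- by move=> x; apply: cvgM; [exact: cvg_cst|exact: ca].
- by rewrite a0 mulr0.
- by rewrite mulr_ge0 ?age0// ltW.
- by rewrite ltr_pM2l ?amono.
Qed.

Lemma class_K_small a (e : R) : class_K a -> 0 < e ->
  exists2 d, 0 < d & a d <= e.
Proof.
move=> [/within_ge0_continuousP /(_ 0)/= ca a0 age0 _] e0.
move/cvgrPdist_le: ca => /(_ e e0)/=.
rewrite maxxx a0 => /nbhs_ballP[d/= d0 ade].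
(* Half the radius: the ball is open, so [d] itself may lie outside it. *)
have d2_gt0 : 0 < d / 2 by rewrite divr_gt0.
exists (d / 2) => //; have := ade (d / 2).
rewrite /ball/= sub0r normrN gtr0_norm// ltr_pdivrMr// ltr_pMr// ltr1n.
move=> /(_ isT); rewrite (max_r (ltW d2_gt0)) sub0r normrN ger0_norm//.
by rewrite age0// ltW.
Qed.

Lemma KinvP a s : (exists2 r, 0 <= r & a r = s) ->
  0 <= Kinv a s /\ a (Kinv a s) = s.
Proof.
by case=> r *; apply: (@xgetPex _ 0 [set r | 0 <= r /\ a r = s]); exists r.
Qed.

(** Inverts the cost bounds. Asking only for a preimage of [s] makes it fit both the [class_Kinf]
    bounds and [rho_lo], whose surjectivity comes from A2. *)
Lemma Kinv_ge a r s : class_K a -> (exists2 r, 0 <= r & a r = s) ->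
  a r <= s -> r <= Kinv a s.
Proof.
move=> [_ _ _ amono] /KinvP[i0 ai] ars; rewrite leNgt; apply/negP => ir.
by have := amono _ _ i0 ir; rewrite ai ltNge ars.
Qed.

Lemma Kinf_surj a s : class_Kinf a -> 0 <= s -> exists2 r, 0 <= r & a r = s.
Proof.
move=> [aK /cvgryPge ay] s0; have [ca a0 _ _] := aK.
(* [a] is at least [s] strictly beyond [B], hence [B + 1]; the maximum with 1 keeps the right end of
   the interval nonnegative. *)
have [B [Breal sB]] := ay s.
pose M := Num.max 1 (B + 1).
have M0 : 0 <= M by rewrite le_max ler01.
have sM : s <= a M by apply: sB; rewrite lt_max ltrDl ltr01 orbT.
have cM : {within `[0, M], continuous a}.
  by apply: continuous_subspaceW ca => x/=; rewrite !in_itv/= andbT => /andP[].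
have [|r + <-] := IVT (v := s) M0 cM.
  by rewrite a0 ge_min s0 le_max sM orbT.
by rewrite in_itv/= => /andP[r0 _]; exists r.
Qed.

(** The equivalences [lt_inv] and [gt_inv] turn bounds on [Kinv a y] into bounds on [y], which
    yields strict monotonicity and continuity. *)
Lemma class_K_Kinv a : class_Kinf a -> class_K (Kinv a).
Proof.
move=> aKi; have [aK _] := aKi; have [_ a0 age0 amono] := aK.
have aI s : 0 <= s -> 0 <= Kinv a s /\ a (Kinv a s) = s.
  by move=> s0; apply/KinvP/Kinf_surj.
have lt_inv r y : 0 <= r -> 0 <= y -> (Kinv a y < r) = (y < a r).
  move=> r0 /aI[i0 ai]; apply/idP/idP => [ir|]; first by rewrite -{1}ai amono.
  by apply: contraTT; rewrite -!leNgt -{2}ai => ri; exact: class_K_le.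
have gt_inv r y : 0 <= r -> 0 <= y -> (r < Kinv a y) = (a r < y).
  move=> r0 /aI[i0 ai]; apply/idP/idP => [ir|]; first by rewrite -{1}ai amono.
  by apply: contraTT; rewrite -!leNgt -{2}ai => ri; exact: class_K_le.
split=> [||s /aI[]//|r s r0 rs]; last 2 first.
- have [i0 ai] := aI 0 (lexx _).
  apply/eqP; rewrite eq_le i0 andbT leNgt; apply/negP => /(amono _ _ (lexx _)).
  by rewrite ai a0 ltxx.
- have [i0 ai] := aI _ r0.
  by rewrite gt_inv ?ai// (le_trans r0 (ltW rs)).
apply/subspace_continuousP => x/=; rewrite in_itv/= andbT => x0.
have [i0 ai] := aI _ x0.
apply/cvgrPdist_lt => e e0; rewrite near_withinE.
have xe : x < a (Kinv a x + e) by rewrite -{1}ai amono// ltrDl.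
have near_lt : \forall y \near x, 0 <= y -> Kinv a y < Kinv a x + e.
  near=> y => y0; rewrite lt_inv//; last by rewrite addr_ge0// ltW.
  by near: y; exact: lt_nbhsl.
have near_gt : \forall y \near x, 0 <= y -> Kinv a x - e < Kinv a y.
  (* If [Kinv a x - e] is negative the bound is trivial; otherwise it is a legitimate argument of
     [a]. *)
  have [ie|ie] := ltP (Kinv a x) e.
    by near=> y => /aI[j0 _]; apply: lt_le_trans j0; rewrite subr_lt0.
  have ex : a (Kinv a x - e) < x by rewrite -{2}ai amono ?subr_ge0// gtrBl.
  near=> y => y0; rewrite gt_inv ?subr_ge0//.
  by near: y; exact: lt_nbhsr.
near=> y => /=; rewrite in_itv/= andbT => y0.
have /(_ y0) lt_y : 0 <= y -> Kinv a y < Kinv a x + e by near: y.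
have /(_ y0) gt_y : 0 <= y -> Kinv a x - e < Kinv a y by near: y.
by rewrite ltr_distlC gt_y.
Unshelve. all: by end_near. Qed.

End ClassK.

(** * The gains of the full-information error bound *)

Section Gains.
Variable R : realType.
Implicit Types a b : R -> R.

Lemma class_KL_K (b : R -> R -> R) t : class_KL b -> 0 <= t -> class_K (b ^~ t).
Proof. by case=> + _; exact. Qed.

Lemma class_KL_ge0 (b : R -> R -> R) s t :
  class_KL b -> 0 <= s -> 0 <= t -> 0 <= b s t.
Proof. by move=> bKL s0 t0; apply: class_K_ge0 (class_KL_K bKL t0) s0. Qed.

Lemma class_KL_le (b : R -> R -> R) s t u :
  class_KL b -> 0 <= s -> 0 <= t -> t <= u -> b s u <= b s t.
Proof. by move=> [_ bL] s0 t0 tu; have [_ _ + _] := bL s s0; exact. Qed.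

(* The largest of three nonnegative numbers is at least a third of their sum. *)
Lemma class_K_add3 a x y z : class_K a -> 0 <= x -> 0 <= y -> 0 <= z ->
  a (x + y + z) <= a (3 * x) + a (3 * y) + a (3 * z).
Proof.
move=> aK x0 y0 z0.
have age0 r : 0 <= r -> 0 <= a (3 * r).
  by move=> r0; apply: class_K_ge0 aK _; rewrite mulr_ge0.
have := age0 _ x0; have := age0 _ y0; have := age0 _ z0.
have le3 r : x + y + z <= 3 * r -> a (x + y + z) <= a (3 * r).
  by apply: class_K_le aK _; rewrite !addr_ge0.
have [xy|yx] := leP x y; [have [yz|zy] := leP y z|have [xz|zx] := leP x z].
- by have := le3 z; lra.
- by have := le3 y; lra.
- by have := le3 z; lra.
- by have := le3 x; lra.
Qed.

(** The three-term splitting is applied twice, first inside [Kinv b] and then to [a]. Attaching [s]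
    to the middle term gives the shape of [fie_aw] and [fie_av]. *)
Lemma class_K_Kinv_add3 a b s x y z : class_K a -> class_Kinf b ->
  0 <= s -> 0 <= x -> 0 <= y -> 0 <= z ->
  a (s + Kinv b (x + y + z)) <= a (3 * Kinv b (3 * x))
    + a (3 * s + 3 * Kinv b (3 * y)) + a (3 * Kinv b (3 * z)).
Proof.
move=> aK bKi s0 x0 y0 z0; have bK := class_K_Kinv bKi.
have ge0 r : 0 <= r -> 0 <= Kinv b (3 * r).
  by move=> r0; apply: class_K_ge0 bK _; rewrite mulr_ge0.
have : a (s + Kinv b (x + y + z)) <=
    a (Kinv b (3 * x) + (s + Kinv b (3 * y)) + Kinv b (3 * z)).
  apply: class_K_le aK _ _.
    by rewrite addr_ge0// (class_K_ge0 bK)// !addr_ge0.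
  by have := class_K_add3 bK x0 y0 z0; lra.
move=> /le_trans; apply; rewrite -(mulrDr 3 s).
by apply: class_K_add3 => //; rewrite ?addr_ge0 ?ge0.
Qed.

Variables (alpha1 alpha2 : R -> R) (rho : R -> R -> R).
Variables (gw_lo gv_lo gw gv : R -> R) (bbx : R -> R -> R) (baw bav : R -> R).
Hypotheses (alpha1_K : class_K alpha1) (alpha2_K : class_K alpha2).
Hypothesis rho_KL : class_KL rho.
Hypotheses (gw_lo_K : class_Kinf gw_lo) (gv_lo_K : class_Kinf gv_lo).
Hypotheses (gw_K : class_Kinf gw) (gv_K : class_Kinf gv).
Hypotheses (bbx_KL : class_KL bbx) (baw_K : class_K baw) (bav_K : class_K bav).

Lemma class_K_gain a b (c : R -> R) : class_K a -> class_Kinf b -> class_K c ->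
  class_K (fun s => a (3 * Kinv b (3 * c s))).
Proof.
move=> aK bK cK; apply: class_K_comp aK _; apply: class_K_scale => //.
by apply: class_K_comp (class_K_Kinv bK) _; exact: class_K_scale.
Qed.

Lemma class_K_gainD a b (c : R -> R) : class_K a -> class_Kinf b -> class_K c ->
  class_K (fun s => a (3 * s + 3 * Kinv b (3 * c s))).
Proof.
move=> aK bK cK; apply: class_K_comp aK _; apply: class_K_add.
  by apply: class_K_scale => //; exact: class_K_id.
apply: class_K_scale => //.
by apply: class_K_comp (class_K_Kinv bK) _; exact: class_K_scale.
Qed.

Let fie_bx := fie_bx alpha1 alpha2 rho gw_lo gv_lo bbx.

Lemma fie_bx_K t : 0 <= t -> class_K (fie_bx ^~ t).
Proof.
move=> t0; have rhoK := class_KL_K rho_KL t0.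
apply: class_K_add; last exact: class_K_gain.
by apply: class_K_add; [exact: class_KL_K|exact: class_K_gain].
Qed.

(** Carries the contraction from [Teta] to every longer horizon, and bounds the error of the first
    steps by the gain at time 0. *)
Lemma fie_bx_le s t u : 0 <= s -> 0 <= t -> t <= u -> fie_bx s u <= fie_bx s t.
Proof.
move=> s0 t0 tu.
have gain_le a b : class_K a -> class_Kinf b ->
    a (3 * Kinv b (3 * rho s u)) <= a (3 * Kinv b (3 * rho s t)).
  move=> aK bK; have u0 := le_trans t0 tu.
  (* With the identity as inner function, the outer gain is of class K, hence monotone in the value
     of [rho]. *)
  have := @class_K_gain a b id aK bK (class_K_id R).
  move=> /class_K_le; apply; first exact: class_KL_ge0.
  exact: class_KL_le.
by rewrite /fie_bx/Defs.fie_bx !lerD ?gain_le//; exact: class_KL_le.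
Qed.

Lemma fie_aw_K : class_K (fie_aw alpha1 alpha2 gw_lo gv_lo gw baw).
Proof.
have [gwK _] := gw_K; apply: class_K_add; last exact: class_K_gain.
by apply: class_K_add => //; exact: class_K_gainD.
Qed.

Lemma fie_av_K : class_K (fie_av alpha1 alpha2 gw_lo gv_lo gv bav).
Proof.
have [gvK _] := gv_K; apply: class_K_add; last exact: class_K_gainD.
by apply: class_K_add => //; exact: class_K_gain.
Qed.

End Gains.

(** * Estimation error on a single window *)

Section WindowError.
Variables (R : realType) (n p g : nat).
Variables (f : 'rV[R]_n -> 'rV[R]_g -> 'rV[R]_n) (h : 'rV[R]_n -> 'rV[R]_p).
Variables (Bx : nat -> set 'rV[R]_n).
Variables (Bw : nat -> forall N, set 'M[R]_(N, g)).
Variables (Bv : nat -> forall N, set 'M[R]_(N, p)).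
Variable V : forall t : nat,
  'rV[R]_n -> 'M[R]_(t, g) -> 'M[R]_(t.+1, p) -> R.
Variables (beta : R -> R -> R) (alpha1 alpha2 : R -> R).
Variables (rho_lo rho : R -> R -> R) (gw_lo gv_lo gw gv : R -> R).
Variables (bbx : R -> R -> R) (baw bav : R -> R).
Hypotheses (beta_KL : class_KL beta).
Hypotheses (alpha1_K : class_K alpha1) (alpha2_K : class_K alpha2).
Hypothesis system_iIOSS : iIOSS f h beta alpha1 alpha2.
Hypothesis A1 : assumption_A1 Bx Bw Bv V rho_lo rho gw_lo gv_lo gw gv.
Hypothesis A2 : assumption_A2 beta rho_lo rho gw gv bbx baw bav.

(** By time invariance, a window can be read as a run started at time 0, the form in which i-IOSS is
    stated. [chi] obeys the dynamics only inside the window, hence [k <= N]. *)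
Lemma traj_window N a (chi : nat -> 'rV[R]_n) (om : nat -> 'rV[R]_g) :
  (forall tau, (a <= tau < a + N)%N -> chi tau.+1 = f (chi tau) (om tau)) ->
  forall k, (k <= N)%N ->
    traj f (chi a) (fun j => om (a + j)%N) k = chi (a + k)%N.
Proof.
move=> chiE; elim=> [|k IHk] kN; first by rewrite addn0.
by rewrite /= IHk ?(ltnW kN)// addnS chiE// leq_addr ltn_add2l.
Qed.

(** An arbitrary window and prior cover both the full-information and the moving-horizon estimates.
    The membership hypotheses make the true trajectory feasible. *)
Lemma window_error d a N prior chi om nu :
  (forall k, Bx k (state f d k)) ->
  (forall k M, Bw k (window k M (sc_w d))) ->
  (forall k M, Bv k (window k M (sc_v d))) ->
  window_optimal f h Bx Bw Bv V a N prior (output f h d) chi om nu ->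
  enorm (state f d (a + N) - chi (a + N)%N) <=
    fie_bx alpha1 alpha2 rho gw_lo gv_lo bbx (enorm (state f d a - prior)) N%:R
    + fie_aw alpha1 alpha2 gw_lo gv_lo gw baw (seqnorm (window a N (sc_w d)))
    + fie_av alpha1 alpha2 gw_lo gv_lo gv bav (seqnorm (window a N.+1 (sc_v d))).
Proof.
move=> dBx dBw dBv [[chiE yE Bchi Bom Bnu] opt].
have [[rho_lo_KL rho_KL] [gw_lo_Ki gv_lo_Ki] [[gw_K _] [gv_K _]]] := A1.
move=> [V1 [V2 [VE _ _ V_bounds]]].
have [_ _ _ rho_lo_surj beta_le] := A2.
set x := state f d in dBx *; set w := sc_w d in dBw *; set v := sc_v d in dBv *.
set sx := enorm (x a - prior).
set sw := seqnorm (window a N w); set sv := seqnorm (window a N.+1 v).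
have sx0 : 0 <= sx by exact: enorm_ge0.
have sw0 : 0 <= sw by exact: seqnorm_ge0.
have sv0 : 0 <= sv by exact: seqnorm_ge0.
have N0 : 0 <= N%:R :> R by [].
have rx0 : 0 <= rho sx N%:R by exact: class_KL_ge0.
have gw0 : 0 <= gw sw by exact: class_K_ge0.
have gv0 : 0 <= gv sv by exact: class_K_ge0.
have [gw_lo_K _] := gw_lo_Ki; have [gv_lo_K _] := gv_lo_Ki.
have rho_loK := class_KL_K rho_lo_KL N0.
pose c := rho sx N%:R + gw sw + gv sv.
have c0 : 0 <= c by rewrite !addr_ge0.
have cost_le : rho_lo (enorm (chi a - prior)) N%:R
    + gw_lo (seqnorm (window a N om)) + gv_lo (seqnorm (window a N.+1 nu)) <= c.
  have [/andP[c1 _] /andP[c2 _]] := V_bounds a N _ prior _ _ Bchi Bom Bnu.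
  have [/andP[_ c3] /andP[_ c4]] :=
    V_bounds a N _ prior _ _ (dBx a) (dBw a N) (dBv a N.+1).
  have : window_cost V a N prior chi om nu <= window_cost V a N prior x w v.
    by apply: opt; split.
  rewrite /window_cost !VE => c5.
  rewrite /c/sx/sw/sv; lra.
(* As all three terms are nonnegative, each one alone is at most [c] and can be inverted. *)
have rho_lo0 : 0 <= rho_lo (enorm (chi a - prior)) N%:R.
  by rewrite class_KL_ge0// enorm_ge0.
have gw_lo0 : 0 <= gw_lo (seqnorm (window a N om)).
  by rewrite class_K_ge0// seqnorm_ge0.
have gv_lo0 : 0 <= gv_lo (seqnorm (window a N.+1 nu)).
  by rewrite class_K_ge0// seqnorm_ge0.
have chi_le : enorm (chi a - prior) <= Kinv (rho_lo ^~ N%:R) c.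
  by apply: Kinv_ge => //; [exact: rho_lo_surj|lra].
have om_le : seqnorm (window a N om) <= Kinv gw_lo c.
  by apply: Kinv_ge => //; [exact: Kinf_surj|lra].
have nu_le : seqnorm (window a N.+1 nu) <= Kinv gv_lo c.
  by apply: Kinv_ge => //; [exact: Kinf_surj|lra].
have x_traj k : traj f (x a) (fun j => w (a + j)%N) k = x (a + k)%N.
  exact: (@traj_window k).
have := system_iIOSS (x a) (chi a)
  (fun j => w (a + j)%N) (fun j => om (a + j)%N) N.
rewrite x_traj (traj_window chiE)// => /le_trans; apply.
have -> : window 0 N (fun j => w (a + j)%N) = window a N w by exact: eq_window.
have -> : window 0 N (fun j => om (a + j)%N) = window a N om by exact: eq_window.
(* Both trajectories explain the same measurements, [h x + v = h chi + nu], so the outputs differ by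
   [nu - v]. *)
have -> : window 0 N.+1 (h \o traj f (x a) (fun j => w (a + j)%N))
    - window 0 N.+1 (h \o traj f (chi a) (fun j => om (a + j)%N))
    = window a N.+1 nu - window a N.+1 v.
  apply/row_matrixP => i; rewrite !linearB/= !rowK/= add0n x_traj.
  have iN : (i <= N)%N by rewrite -ltnS ltn_ord.
  rewrite (traj_window chiE)//.
  have := yE (a + i)%N; rewrite leq_addr leq_add2l => /(_ iN).
  rewrite /output -/x -/v => yi.
  by apply/eqP; rewrite subr_eq addrAC (addrC (nu _)) -yi addrK.
have beta_bound :
    beta (enorm (x a - chi a)) N%:R <= bbx sx N%:R + baw sw + bav sv.
  apply: le_trans (beta_le _ _ _ N sx0 sw0 sv0).
  apply: class_K_le (class_KL_K beta_KL N0) (enorm_ge0 _) _.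
  (* Passing through the prior produces the argument of [beta] in A2. *)
  have -> : x a - chi a = (x a - prior) - (chi a - prior).
    by rewrite opprB addrA subrK.
  by rewrite (le_trans (enormB _ _))// lerD2l.
have w_bound : alpha1 (seqnorm (window a N w - window a N om)) <=
    alpha1 (sw + Kinv gw_lo c).
  apply: class_K_le => //; first exact: seqnorm_ge0.
  by rewrite (le_trans (seqnormB _ _))// lerD2l.
have v_bound : alpha2 (seqnorm (window a N.+1 nu - window a N.+1 v)) <=
    alpha2 (sv + Kinv gv_lo c).
  apply: class_K_le => //; first exact: seqnorm_ge0.
  by rewrite (le_trans (seqnormB _ _))// addrC lerD2l.
(* The middle term is the one grouped with the true signal: [gw sw] for [alpha1], [gv sv] for
   [alpha2]. The second sum is then reordered into [c]. *)
have := class_K_Kinv_add3 alpha1_K gw_lo_Ki sw0 rx0 gw0 gv0.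
have := class_K_Kinv_add3 alpha2_K gv_lo_Ki sv0 rx0 gv0 gw0.
rewrite (addrAC (rho _ _)) -/c /fie_bx /fie_aw /fie_av.
lra.
Qed.

End WindowError.

(** * Sequences contracting with a delay *)

Section DelayedContraction.
Variables (R : realType) (eta : R) (T : nat).
Hypotheses (eta_itv : 0 < eta < 1) (T_gt0 : (0 < T)%N).
Implicit Types (e c : nat -> R) (B C : R).

Let eta_gt0 : 0 < eta. Proof. by case/andP: eta_itv. Qed.
Let eta_lt1 : eta < 1. Proof. by case/andP: eta_itv. Qed.

(* [eta ^ (t / T - 1)]: one contraction per [T] steps, the exponent being
   nonpositive on the first [T] steps. *)
Definition decay (t : R) : R := expR ((t / T%:R - 1) * ln eta).

Lemma decay_class_L B : 0 <= B -> class_L (fun t => B * decay t).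
Proof.
move=> B0; have lneta : ln eta < 0 by rewrite ln_lt0.
have T0 : 0 < T%:R :> R by rewrite ltr0n.
split=> [|t t0|t u t0 tu|].
- apply: continuous_subspaceT => t; apply: cvgM; first exact: cvg_cst.
  apply: (@continuous_comp _ _ _ (fun t : R => (t / T%:R - 1) * ln eta) expR);
    last exact: continuous_expR.
  apply: cvgM; last exact: cvg_cst.
  apply: cvgB; last exact: cvg_cst.
  by apply: cvgM; [exact: cvg_id|exact: cvg_cst].
- by rewrite mulr_ge0// expR_ge0.
- by rewrite ler_wpM2l// ler_expR ler_wnM2r ?(ltW lneta)// lerD2r
    ler_wpM2r// invr_ge0 ltW.
- rewrite -[X in _ --> X](mulr0 B); apply: cvgM; first exact: cvg_cst.
  (* The exponent is written as the opposite of a quantity tending to infinity, since [ln eta] is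
     negative. *)
  have -> : decay = fun t => expR (- ((t / T%:R - 1) * - ln eta)).
    by apply/funext => t; rewrite mulrN opprK.
  apply: (@cvg_comp _ _ _ (fun t => (t / T%:R - 1) * - ln eta)
    (fun x => expR (- x)) _ +oo); last exact: cvgr_expR.
  apply: gt0_cvgMly; first by rewrite oppr_gt0.
  apply/cvgryPge => A; near=> t.
  rewrite lerBrDr ler_pdivlMr//; near: t; exact: nbhs_pinfty_ge.
Unshelve. all: by end_near. Qed.

(** Strong induction in strides of [T]: [decay] is at least 1 up to time [T], each stride multiplies
    it by [eta], and [C / (1 - eta)] is the fixed point of [K -> eta K + C]. The hypotheses stop at
    [t] because [C] will depend on [t]. *)
Lemma delayed_contraction_le e B C t : 0 <= B -> 0 <= C ->
  (forall s, (s <= t)%N -> (s <= T)%N -> e s <= B + C) ->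
  (forall s, (s <= t)%N -> (T < s)%N -> e s <= eta * e (s - T)%N + C) ->
  e t <= B * decay t%:R + (1 - eta)^-1 * C.
Proof.
move=> B0 C0 init step.
have lneta : ln eta < 0 by rewrite ln_lt0.
have T0 : 0 < T%:R :> R by rewrite ltr0n.
have eta1_gt0 : 0 < 1 - eta by rewrite subr_gt0.
suff: forall s, (s <= t)%N -> e s <= B * decay s%:R + (1 - eta)^-1 * C by exact.
elim/ltn_ind => s IHs st; have [sT|Ts] := leqP s T.
  rewrite (le_trans (init s st sT))// lerD//.
    rewrite ler_peMr// -[leLHS]expR0 ler_expR mulr_le0 ?(ltW lneta)//.
    by rewrite subr_le0 ler_pdivrMr// mul1r ler_nat.
  by rewrite ler_peMl// invf_ge1// gerBl ltW.
rewrite (le_trans (step s st Ts))//.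
have /IHs : (s - T < s)%N by rewrite ltn_subrL T_gt0 (leq_trans _ Ts).
rewrite (leq_trans (leq_subr _ _) st) => /(_ isT) IH.
have decayS : eta * decay (s - T)%:R = decay s%:R.
  rewrite /decay -{1}(lnK eta_gt0) -expRD natrB ?(ltnW Ts)//; congr expR.
  by rewrite (mulrBl T%:R^-1) divff ?gt_eqF//; ring.
have CE : C = (1 - eta) * ((1 - eta)^-1 * C).
  by rewrite mulrA divff ?mul1r// gt_eqF.
rewrite -decayS; move: CE IH; set K := _ * C => CE IH.
have := ler_wpM2l (ltW eta_gt0) IH; rewrite CE; lra.
Qed.

(** The contraction may be used only where the delayed value already satisfies the bound, which the
    induction supplies. The bound persists since [eta B <= B] and [C / (1 - eta)] is a fixed
    point. *)
Lemma delayed_contraction_bounded e B C : 0 <= B -> 0 <= C ->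
  (forall s, (s <= T)%N -> e s <= B + C) ->
  (forall s, (T < s)%N -> e (s - T)%N <= B + (1 - eta)^-1 * C ->
    e s <= eta * e (s - T)%N + C) ->
  forall s, e s <= B + (1 - eta)^-1 * C.
Proof.
move=> B0 C0 init step; have eta1_gt0 : 0 < 1 - eta by rewrite subr_gt0.
elim/ltn_ind => s IHs; have [sT|Ts] := leqP s T.
  by rewrite (le_trans (init s sT))// lerD2l ler_peMl// invf_ge1// gerBl ltW.
have IH : e (s - T)%N <= B + (1 - eta)^-1 * C.
  by apply: IHs; rewrite ltn_subrL T_gt0 (leq_trans _ Ts).
rewrite (le_trans (step s Ts IH))//.
have CE : C = (1 - eta) * ((1 - eta)^-1 * C).
  by rewrite mulrA divff ?mul1r// gt_eqF.
move: CE IH; set K := _ * C => CE IH.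
have := ler_wpM2l (ltW eta_gt0) IH.
have := ler_wpM2r B0 (ltW eta_lt1); rewrite CE; lra.
Qed.

Lemma delayed_contraction_cvg0 e c B : (forall s, 0 <= e s <= B) ->
  (forall s, (T < s)%N -> e s <= eta * e (s - T)%N + c s) ->
  (forall eps, 0 < eps -> exists N, forall s, (N <= s)%N -> c s <= eps) ->
  e s @[s --> \oo] --> 0.
Proof.
move=> eB step c0; have eta1_gt0 : 0 < 1 - eta by rewrite subr_gt0.
have B0 : 0 <= B by have /andP[e0 e0B] := eB 0%N; exact: le_trans e0 e0B.
apply/cvgrPdist_le => eps eps0.
(* This tolerance makes [eps / 2] the fixed point of [K -> eta K + (1 - eta) (eps / 2)]; the other
   half of [eps] is left for [eta ^+ k * B]. *)
have [|N cN] := c0 ((1 - eta) * (eps / 2)); first by rewrite mulr_gt0// divr_gt0.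
have iter k : forall s, (N + T + k * T < s)%N -> e s <= eta ^+ k * B + eps / 2.
  elim: k => [|k IHk] s Ns.
    have /andP[_ esB] := eB s.
    by rewrite expr0 mul1r (le_trans esB)// lerDl divr_ge0// ltW.
  have Ts : (T < s)%N.
    by apply: leq_ltn_trans Ns; rewrite -addnA addnCA leq_addr.
  have NsT : (N + T + k * T < s - T)%N.
    by rewrite ltn_subRL addnCA -mulSn.
  rewrite (le_trans (step s Ts))//.
  have cs : c s <= (1 - eta) * (eps / 2).
    by apply: cN; apply: leq_trans (ltnW Ns); rewrite -addnA leq_addr.
  have := ler_wpM2l (ltW eta_gt0) (IHk _ NsT); rewrite exprS; lra.
have /cvgrPdist_le /(_ (eps / 2)) : eta ^+ k * B @[k --> \oo] --> 0.
  rewrite -[X in _ --> X](mul0r B); apply: cvgM; last exact: cvg_cst.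
  by apply: cvg_expr; rewrite gtr0_norm.
rewrite divr_gt0// => /(_ isT) [k _ /(_ k (leqnn k))/=].
rewrite sub0r normrN ger0_norm ?mulr_ge0 ?exprn_ge0 ?(ltW eta_gt0)// => etak.
exists (N + T + k * T).+1 => // s/= Ns.
have /andP[es0 _] := eB s.
rewrite sub0r normrN ger0_norm//; have := iter k s Ns; lra.
Qed.

End DelayedContraction.

(** The window starts at [t - T], which tends to infinity with [t], so all its entries eventually
    fall below the threshold at which the gain is small. *)
Lemma window_gain_cvg0 (R : realType) (q T : nat) (a : R -> R)
    (u : nat -> 'rV[R]_q) (N : nat) :
  class_K a -> enorm (u t) @[t --> \oo] --> 0 ->
  forall eps, 0 < eps -> exists t0, forall t, (t0 <= t)%N ->
    a (seqnorm (window (t - T) N u)) <= eps.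
Proof.
move=> aK /cvgrPdist_le u0 eps eps0.
have [d d0 ad] := class_K_small aK eps0.
have [t0 _ ud] := u0 d d0.
exists (t0 + T)%N => t t0T; apply: le_trans ad.
apply: class_K_le aK (seqnorm_ge0 _) _.
apply: window_le => [|j /andP[tTj _]]; first exact: ltW.
have /ud/= : (t0 <= j)%N.
  apply: leq_trans tTj.
  by rewrite leq_subRL ?(leq_trans (leq_addl _ _) t0T)// addnC.
by rewrite sub0r normrN ger0_norm// enorm_ge0.
Qed.

(** * Robust stability and convergence of the moving-horizon estimate *)

Theorem theorem2 (R : realType) (n p g : nat)
  (f : 'rV[R]_n -> 'rV[R]_g -> 'rV[R]_n) (h : 'rV[R]_n -> 'rV[R]_p)
  (Bx : nat -> set 'rV[R]_n)
  (Bw : nat -> forall N, set 'M[R]_(N, g))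
  (Bv : nat -> forall N, set 'M[R]_(N, p))
  (V : forall t : nat, 'rV[R]_n -> 'M[R]_(t, g) -> 'M[R]_(t.+1, p) -> R)
  (beta : R -> R -> R) (alpha1 alpha2 : R -> R)
  (rho_lo rho : R -> R -> R) (gw_lo gv_lo gw gv : R -> R)
  (bbx : R -> R -> R) (baw bav : R -> R)
  (M0 Mw Mv eta : R) (Teta T : nat)
  (xbar xhat : scenario R n p g -> nat -> 'rV[R]_n)
  (adm := admissible f Bx Bw Bv M0 Mw Mv)
  (f_continuous : continuous (fun q : 'rV[R]_n * 'rV[R]_g => f q.1 q.2))
  (h_continuous : continuous h)
  (beta_KL : class_KL beta) (alpha1_K : class_K alpha1)
  (alpha2_K : class_K alpha2)
  (system_iIOSS : iIOSS f h beta alpha1 alpha2)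
  (A1 : assumption_A1 Bx Bw Bv V rho_lo rho gw_lo gv_lo gw gv)
  (A2 : assumption_A2 beta rho_lo rho gw gv bbx baw bav)
  (eta_itv : 0 < eta < 1)
  (contraction : forall s : R,
     0 <= s <= sbar alpha1 alpha2 rho gw_lo gv_lo gw gv bbx baw bav
                 eta M0 Mw Mv ->
     bbx s Teta%:R + alpha1 (3 * Kinv gw_lo (3 * rho s Teta%:R))
       + alpha2 (3 * Kinv gv_lo (3 * rho s Teta%:R)) <= eta * s)
  (T_gt0 : (0 < T)%N) (T_ge : (Teta <= T)%N)
  (mhe_attained : forall d, adm d -> forall t,
     mhe_attainable f h Bx Bw Bv V T xbar d t)
  (xhat_mhe : forall d, adm d -> forall t,
     is_mhe_estimate f h Bx Bw Bv V T xbar d t (xhat d t))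
  (xbar_0 : forall d, adm d -> xbar d 0%N = sc_xbar0 d)
  (xbar_prior : forall d, adm d -> forall t, (T + 1 <= t)%N ->
     enorm (state f d (t - T)%N - xbar d (t - T)%N)
     <= enorm (state f d (t - T)%N - xhat d (t - T)%N)) :
  RGAS f adm xhat /\
  (forall d, adm d ->
     enorm (sc_w d t) @[t --> \oo] --> 0 ->
     enorm (sc_v d t) @[t --> \oo] --> 0 ->
     enorm (state f d t - xhat d t) @[t --> \oo] --> 0).
Proof.
have [[rho_lo_KL rho_KL] [gw_lo_Ki gv_lo_Ki] [gw_Ki gv_Ki] _] := A1.
have [bbx_KL baw_K bav_K _ _] := A2.
have /andP[_ eta_lt1] := eta_itv.
have eta1_gt0 : 0 < (1 - eta)^-1 by rewrite invr_gt0 subr_gt0.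
pose bx := fie_bx alpha1 alpha2 rho gw_lo gv_lo bbx.
pose aw := fie_aw alpha1 alpha2 gw_lo gv_lo gw baw.
pose av := fie_av alpha1 alpha2 gw_lo gv_lo gv bav.
have bx_K (t : R) : 0 <= t -> class_K (bx ^~ t) by exact: fie_bx_K.
have bx_le (s t u : R) : 0 <= s -> 0 <= t -> t <= u -> bx s u <= bx s t.
  exact: fie_bx_le.
have aw_K : class_K aw by exact: fie_aw_K.
have av_K : class_K av by exact: fie_av_K.
pose e d t := enorm (state f d t - xhat d t).
have e_ge0 d t : 0 <= e d t by exact: enorm_ge0.
pose s0 (d : scenario R n p g) := enorm (sc_x0 d - sc_xbar0 d).
pose Cwv (d : scenario R n p g) a N := aw (seqnorm (window a N (sc_w d)))
  + av (seqnorm (window a N.+1 (sc_v d))).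
have error_init d t : adm d -> (t <= T)%N ->
    e d t <= bx (s0 d) t%:R + Cwv d 0%N t.
  move=> dadm tT; have [dBx dBw dBv _ _] := dadm.
  have [chi [om [nu [opt xhatE]]]] := xhat_mhe d dadm t.
  rewrite /e xhatE /Cwv addrA.
  move: opt; rewrite /mhe_optimal.
  have [lt_tT|le_Tt] := ltnP t T.
    exact: (window_error beta_KL alpha1_K alpha2_K system_iIOSS A1 A2).
  (* At [t = T] the moving window starts at time 0 with the initial prior, so this case still
     belongs to the initial phase. *)
  have -> : t = T by apply/eqP; rewrite eqn_leq tT.
  rewrite subnn xbar_0//.
  exact: (window_error beta_KL alpha1_K alpha2_K system_iIOSS A1 A2).
have error_step d t : adm d -> (T < t)%N ->
    e d t <= bx (e d (t - T)%N) T%:R + Cwv d (t - T)%N T.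
  move=> dadm Tt; have [dBx dBw dBv _ _] := dadm.
  have [chi [om [nu [+ xhatE]]]] := xhat_mhe d dadm t.
  rewrite /mhe_optimal ltnNge (ltnW Tt)/= => opt.
  have := window_error beta_KL alpha1_K alpha2_K system_iIOSS A1 A2
    dBx dBw dBv opt.
  rewrite subnK ?(ltnW Tt)// -xhatE -addrA => /le_trans; apply.
  rewrite lerD2r; apply: class_K_le (bx_K T%:R (ler0n _ _)) (enorm_ge0 _) _.
  by apply: xbar_prior => //; rewrite addn1.
have Cwv_le d a N b M : (b <= a)%N -> (a + N <= b + M)%N ->
    Cwv d a N <= Cwv d b M.
  move=> ba aNbM; apply: lerD.
    by apply: class_K_le aw_K (seqnorm_ge0 _) _; exact: window_sub.
  apply: class_K_le av_K (seqnorm_ge0 _) _.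
  by apply: window_sub; rewrite ?addnS ?ltnS.
have Cwv_ge0 d a N : 0 <= Cwv d a N.
  by apply: addr_ge0; [apply: class_K_ge0 aw_K _|apply: class_K_ge0 av_K _];
    exact: seqnorm_ge0.
have s0_ge0 d : 0 <= s0 d by exact: enorm_ge0.
have bx0_ge0 (s : R) : 0 <= s -> 0 <= bx s 0.
  by move=> ?; apply: class_K_ge0 (bx_K 0 (lexx _)) _.
(* This is [sbar], the range on which the contraction is assumed. *)
pose sb := bx M0 0 + (1 - eta)^-1 * (aw Mw + av Mv).
have bx_contr s : 0 <= s -> s <= sb -> bx s T%:R <= eta * s.
  move=> s_ge0 s_le; apply: le_trans (contraction s _); last by rewrite s_ge0.
  by apply: bx_le; rewrite ?ler_nat.
have Cwv_bound d a N : adm d -> Cwv d a N <= aw Mw + av Mv.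
  move=> [_ _ _ _ wv]; apply: lerD.
    apply: class_K_le aw_K (seqnorm_ge0 _) _; apply: window_le => [|j _].
      by have [/(le_trans (enorm_ge0 _))] := wv 0%N.
    by have [] := wv j.
  apply: class_K_le av_K (seqnorm_ge0 _) _; apply: window_le => [|j _].
    by have [_ /(le_trans (enorm_ge0 _))] := wv 0%N.
  by have [] := wv j.
(* The uniform bounds on the data first confine the error to [[0, sb]]; from there on the
   contraction holds at every step. *)
have e_bound d t : adm d -> e d t <= sb.
  move=> dadm; have [_ _ _ s0_le _] := dadm.
  apply: (delayed_contraction_bounded eta_itv T_gt0) => [|||s Ts s_le].
  - by apply: bx0_ge0; apply: le_trans s0_le; exact: enorm_ge0.
  - by rewrite (le_trans (Cwv_ge0 d 0%N 0%N))// Cwv_bound.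
  - move=> s sT; apply: le_trans (error_init d s dadm sT) _.
    apply: lerD; last exact: Cwv_bound.
    apply: le_trans (bx_le _ 0 _ (s0_ge0 d) (lexx _) (ler0n _ _)) _.
    exact: class_K_le (bx_K 0 (lexx _)) (enorm_ge0 _) s0_le.
  - apply: le_trans (error_step d s dadm Ts) _.
    by apply: lerD; [exact: bx_contr|exact: Cwv_bound].
have error_contr d t : adm d -> (T < t)%N ->
    e d t <= eta * e d (t - T)%N + Cwv d (t - T)%N T.
  move=> dadm Tt; apply: le_trans (error_step d t dadm Tt) _.
  by rewrite lerD2r; apply: bx_contr => //; exact: e_bound.
split.
  (* [bx s 0] dominates the initial phase, and the factor [(1 - eta)^-1] sums the geometric series
     of disturbance contributions. *)
  exists (fun s t => bx s 0 * decay eta T t), (fun s => (1 - eta)^-1 * aw s),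
    (fun s => (1 - eta)^-1 * av s); split.
  - split=> [t t0|s s_ge0]; last first.
      exact: (decay_class_L eta_itv T_gt0 (bx0_ge0 s s_ge0)).
    under eq_fun do rewrite mulrC.
    by apply: class_K_scale (bx_K 0 (lexx _)); exact: expR_gt0.
  - exact: class_K_scale.
  - exact: class_K_scale.
  move=> d dadm t; rewrite -addrA -mulrDr.
  (* The constants now come from the actual data of the run up to [t], not from the uniform
     bounds. *)
  apply: (delayed_contraction_le (e := e d) eta_itv T_gt0 (bx0_ge0 _ (s0_ge0 d))
    (Cwv_ge0 d 0%N t)) => s st; last first.
    move=> Ts; apply: le_trans (error_contr d s dadm Ts) _.
    by rewrite lerD2l Cwv_le// subnK ?add0n// ltnW.
  move=> sT; apply: le_trans (error_init d s dadm sT) _.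
  by apply: lerD; [exact: bx_le|exact: Cwv_le].
move=> d dadm w0 v0.

apply: (delayed_contraction_cvg0 (e := e d)
  (c := fun t => Cwv d (t - T)%N T) eta_itv (B := sb)) => [t|t|eps eps0].
- by rewrite e_ge0 e_bound.
- exact: error_contr.
have eps2 : 0 < eps / 2 by rewrite divr_gt0.
have [Nw wN] := window_gain_cvg0 T T aw_K w0 eps2.
have [Nv vN] := window_gain_cvg0 T T.+1 av_K v0 eps2.
exists (maxn Nw Nv) => t; rewrite geq_max => /andP[/wN wt /vN vt].
by rewrite (splitr eps) lerD.
Qed.
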